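(* For $a=1,2$ let $\mathbb J_a=J^{k_1^a}(\mathbb R,\mathbb R)\times\cdots\times J^{k^a_{n_a}}(\mathbb R,\mathbb R)$ with multi-contact distribution $\mathcal C(\kappa_a)$. Suppose $\mu_a:G\times\mathbb J_a\to\mathbb J_a$ ($a=1,2$) are admissible actions of a Lie group $G$, so that $\mu_a$ preserves $\mathcal C(\kappa_a)$ for each $a$, and let $\boldsymbol{\phi^1}:\mathbb J_1\to\mathcal S_1\times G$ and $\boldsymbol{\phi^2}:\mathbb J_2\to\mathcal S_2\times G$ be their right and left augmented moving frames, respectively. Then there are (vector-valued) functions $\vec h_j,\vec k_j$ on $\mathcal S_1$ ($1\le j\le n_1$) and functions $\vec m_l,\vec n_l$ on $\mathcal S_2$ ($1\le l\le n_2$) such that $$\boldsymbol{\phi^1}_*\mathcal C(\kappa_1)=\bigoplus_{j=1}^{n_1}\Big\{\partial_{\alpha_j}+\vec h_j(\boldsymbol\alpha,\boldsymbol\varpi,\boldsymbol u)\cdot\partial_{\boldsymbol\varpi}+\vec k_j(\boldsymbol\alpha,\boldsymbol\varpi,\boldsymbol u)\cdot\boldsymbol L_1,\ \partial_{u_j}\Big\},$$ $$\boldsymbol{\phi^2}_*\mathcal C(\kappa_2)=\bigoplus_{l=1}^{n_2}\Big\{\partial_{\beta_l}+\vec m_l(\boldsymbol\beta,\boldsymbol\varsigma,\boldsymbol v)\cdot\partial_{\boldsymbol\varsigma}+\vec n_l(\boldsymbol\beta,\boldsymbol\varsigma,\boldsymbol v)\cdot\boldsymbol R_2,\ \partial_{v_l}\Big\},$$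 where $\boldsymbol L_1$ is a basis of the Lie algebra $\mathfrak L_1$ of infinitesimal left-translations on the factor $G$ of $\mathcal S_1\times G$ and $\boldsymbol R_2$ is a basis of the Lie algebra $\mathfrak R_2$ of infinitesimal right-translations on the factor $G$ of $\mathcal S_2\times G$.
   Context: Everything is smooth and local; all distributions have constant rank. Curly brackets denote the distribution spanned; a dot denotes the sum of products of components (e.g. $\vec h\cdot\partial_{\boldsymbol\varpi}=\sum_s h^s\partial_{\varpi_s}$). Multi-contact distributions. $\kappa_a=\langle k_1^a,\dots,k^a_{n_a}\rangle$ is a sequence of positive integers. On $\mathbb J_1$, the $i$-th factor $J^{k_i^1}(\mathbb R,\mathbb R)$ has standard coordinates $\alpha_i,x^i=x^i_0,x_1^i,\dots,x^i_{k^1_i}$ and contact distribution $\mathcal C^{k_i^1}=\{\partial_{\alpha_i}+x_1^i\partial_{x^i}+\cdots+x^i_{k^1_i}\partial_{x^i_{k_i^1-1}},\ \partial_{x^i_{k_i^1}}\}$; $\mathcal C(\kappa_1)=\bigoplus_{i=1}^{n_1}\mathcal C^{k_i^1}$. Likewise on $\mathbb J_2$ with coordinates $\beta_j,y^j=y^j_0,y^j_1,\dots,y^j_{k_j^2}$, $1\le j\le n_2$, and $\mathcal C(\kappa_2)=\bigoplus_{j=1}^{n_2}\mathcal C^{k_j^2}$. Admissible actions. $G$ is a finite-dimensional Lie group of dimension $r$ acting diagonally on $\mathbb J_a$ (i.e. simultaneously on all factors, by contact transformations of each factor, without permuting factors) by symmetries of $\mathcal C(\kappa_a)$. The actions $\mu_1,\mu_2$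 are admissible if: (A1) each of $\mu_1,\mu_2$ is free and regular, $\mu_1$ preserves every $\alpha_i$ and $\mu_2$ preserves every $\beta_j$; (A2) for each $i$ there is exactly one invariant $u_i$ of $\mu_1$ (in the complete set of functionally independent invariants used below) with $\partial u_i/\partial x^i_{k_i^1}\ne0$, and for each $j$ exactly one invariant $v_j$ of $\mu_2$ with $\partial v_j/\partial y^j_{k_j^2}\neq0$; (A3) all other invariants of $\mu_a$, and the components of its moving frame, have order lower than $\min(k_1^a,\dots,k_{n_a}^a)$, where the order of a function is the highest derivative index of the jet coordinates on which it depends; (A4) $\dim\mathbb J_1+\dim\mathbb J_2-\dim G=3n+1$, $n=n_1+n_2$. Augmented moving frames. $\rho:\mathbb J_1\to G$ is a right moving frame for $\mu_1$, i.e. $\rho(\mu_1(g)\boldsymbol x)=\rho(\boldsymbol x)g^{-1}$, and $\lambda:\mathbb J_2\to G$ a left moving frame for $\mu_2$, i.e. $\lambda(\mu_2(g)\boldsymbol y)=g\,\lambda(\boldsymbol y)$. A complete set of functionally independent invariants of $\mu_1$ is $\boldsymbol\alpha=(\alpha_1,\dots,\alpha_{n_1})$, $\boldsymbol\varpi=(\varpi_1,\dots,\varpi_{s_1})$, $\boldsymbol u=(u_1,\dots,u_{n_1})$, and of $\mu_2$ it is $\boldsymbol\beta=(\beta_1,\dots,\beta_{n_2})$, $\boldsymbol\varsigma=(\varsigma_1,\dots,\varsigma_{s_2})$, $\boldsymbol v=(v_1,\dots,v_{n_2})$. These are local coordinates on $\mathcal S_1=\mathbb J_1/G$ and $\mathcal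 S_2=\mathbb J_2/G$, respectively. The right and left augmented moving frames are the local diffeomorphisms $\boldsymbol{\phi^1}(\boldsymbol x)=(\boldsymbol\alpha,\boldsymbol\varpi,\boldsymbol u,\rho(\boldsymbol x))$ and $\boldsymbol{\phi^2}(\boldsymbol y)=(\boldsymbol\beta,\boldsymbol\varsigma,\boldsymbol v,\lambda(\boldsymbol y))$. Infinitesimal left-translations are the generators of left multiplication on $G$ (right-invariant vector fields); infinitesimal right-translations are the generators of right multiplication (left-invariant vector fields). *)

(* Defs.v *)
From HB Require Import structures.
From mathcomp Require Import all_boot all_order all_algebra.
From mathcomp Require Import all_classical all_reals all_analysis.
From Stdlib Require Import Relation_Operators.

Set Implicit Arguments.
Unset Strict Implicit.
Unset Printing Implicit Defensive.

Import Order.TTheory GRing.Theory Num.Theory.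
Import numFieldNormedType.Exports.
Local Open Scope classical_set_scope.
Local Open Scope ring_scope.

(* Smooth maps between (finite-dimensional) normed spaces.  The set [A] is
   open in all uses: [f] is C^(n+1) on [A] when it is Frechet differentiable
   on [A] with all directional derivatives C^n. *)
Section Smooth.
Context {R : realType} {E F : normedModType R}.

Fixpoint Cn_on (n : nat) (A : set E) (f : E -> F) : Prop :=
  if n is m.+1 then
    (forall x, A x -> differentiable f x) /\
    (forall v, Cn_on m A (fun x => 'D_v f x))
  else forall x, A x -> {for x, continuous f}.

Definition smooth_on (A : set E) (f : E -> F) := forall n, Cn_on n A f.

End Smooth.

Lemma open_setX (T T' : topologicalType) (A : set T) (B : set T') :
  open A -> open B -> open (A `*` B).
Proof.
rewrite !openE => oA oB [x y] [/= Ax By]; exists (A, B) => //=.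
by split; [exact: oA | exact: oB].
Qed.

Section Atlas.
Context {R : realType}.

Record chart (E : normedModType R) (M : topologicalType) := Chart {
  cdom : set M;
  cmap : M -> E;
  cinv : E -> M;
  cdom_open : open cdom;
  cimg_open : open (cmap @` cdom);
  cmapK : forall p, cdom p -> cinv (cmap p) = p;
  cmap_continuous : forall p, cdom p -> {for p, continuous cmap};
  cinv_continuous : forall t, (cmap @` cdom) t -> {for t, continuous cinv} }.

(* An atlas comes with a preferred chart [chart_at p] at each point; the
   tangent space at [p] is identified with the model space [E] through it.
   Smooth compatibility of the charts is a field of [lie_group] below; it is
   automatic for [eucl] and inherited by products. *)
Record atlas (E : normedModType R) (M : topologicalType) := Atlas {
  charts : set (chart E M);
  chart_at : M -> chart E M;
  chart_at_charts : forall p, charts (chart_at p);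
  chart_at_dom : forall p, cdom (chart_at p) p }.

Lemma eucl_image_open (E : normedModType R) : open (@id E @` setT).
Proof. by rewrite image_id; exact: openT. Qed.

Definition eucl_chart (E : normedModType R) : chart E E :=
  @Chart E E setT id id openT (@eucl_image_open E) (fun _ _ => erefl)
    (fun p _ => @cvg_id _ (nbhs p)) (fun p _ => @cvg_id _ (nbhs p)).

Definition eucl (E : normedModType R) : atlas E E :=
  @Atlas E E [set eucl_chart E] (fun=> eucl_chart E)
    (fun _ => erefl) (fun _ => I).

Section Product.
Context {E F : normedModType R} {M N : topologicalType}.

Let pmap (c : chart E M) (d : chart F N) (p : M * N) : E * F :=
  (cmap c p.1, cmap d p.2).
Let pinv (c : chart E M) (d : chart F N) (t : E * F) : M * N :=
  (cinv c t.1, cinv d t.2).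

Lemma prod_image c d :
  pmap c d @` (cdom c `*` cdom d) =
  (cmap c @` cdom c) `*` (cmap d @` cdom d).
Proof.
apply/seteqP; split=> [_ [[p q] [/= cp dq] <-]|[s t] [/= [p cp <-] [q dq <-]]].
  by split; [exists p | exists q].
by exists (p, q).
Qed.

Lemma prod_image_open c d : open (pmap c d @` (cdom c `*` cdom d)).
Proof. by rewrite prod_image; apply: open_setX; exact: cimg_open. Qed.

Lemma prod_mapK c d p : (cdom c `*` cdom d) p -> pinv c d (pmap c d p) = p.
Proof. by case: p => p q [/= cp dq]; rewrite /pinv /= !cmapK. Qed.

Lemma prod_map_continuous c d p :
  (cdom c `*` cdom d) p -> {for p, continuous (pmap c d)}.
Proof.
move=> [cp dq]; apply: cvg_pair => /=.
  by apply: (cvg_comp _ _ cvg_fst); exact: (cmap_continuous cp).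
by apply: (cvg_comp _ _ cvg_snd); exact: (cmap_continuous dq).
Qed.

Lemma prod_inv_continuous c d t : (pmap c d @` (cdom c `*` cdom d)) t ->
  {for t, continuous (pinv c d)}.
Proof.
rewrite prod_image => -[ct dt]; apply: cvg_pair => /=.
  by apply: (cvg_comp _ _ cvg_fst); exact: (cinv_continuous ct).
by apply: (cvg_comp _ _ cvg_snd); exact: (cinv_continuous dt).
Qed.

Definition prod_chart (c : chart E M) (d : chart F N) :
    chart (E * F)%type (M * N)%type :=
  Chart (open_setX (cdom_open c) (cdom_open d)) (@prod_image_open c d)
    (@prod_mapK c d) (@prod_map_continuous c d) (@prod_inv_continuous c d).

Lemma prod_chart_at_charts (A : atlas E M) (B : atlas F N) (p : M * N) :
  exists2 c, charts A c & exists2 d, charts B d &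
    prod_chart c d = prod_chart (chart_at A p.1) (chart_at B p.2).
Proof.
by exists (chart_at A p.1); [|exists (chart_at B p.2)];
  first [exact: chart_at_charts | by []].
Qed.

Lemma prod_chart_at_dom (A : atlas E M) (B : atlas F N) (p : M * N) :
  cdom (prod_chart (chart_at A p.1) (chart_at B p.2)) p.
Proof. by split; exact: chart_at_dom. Qed.

Definition prod_atlas (A : atlas E M) (B : atlas F N) :
    atlas (E * F)%type (M * N)%type :=
  @Atlas _ _
    [set e | exists2 c, charts A c & exists2 d, charts B d & prod_chart c d = e]
    (fun p => prod_chart (chart_at A p.1) (chart_at B p.2))
    (prod_chart_at_charts A B) (prod_chart_at_dom A B).

End Product.

Section Maps.
Context {E F : normedModType R} {M N : topologicalType}.
Context (A : atlas E M) (B : atlas F N).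

Definition smooth_map (U : set M) (f : M -> N) : Prop :=
  (forall p, U p -> {for p, continuous f}) /\
  (forall c d, charts A c -> charts B d ->
     smooth_on (cmap c @` (cdom c `&` U `&` f @^-1` cdom d))
               (cmap d \o f \o cinv c)).

Definition mdiff (f : M -> N) (p : M) : {linear E -> F} :=
  'd (cmap (chart_at B (f p)) \o f \o cinv (chart_at A p))
     (cmap (chart_at A p) p).

End Maps.

Definition local_diffeo {E F : normedModType R} {M N : topologicalType}
    (A : atlas E M) (B : atlas F N) (U : set M) (f : M -> N) : Prop :=
  smooth_map A B U f /\
  forall p, U p -> exists W : set M, exists g : N -> M,
    [/\ open W, W p, W `<=` U & open (f @` W)] /\
    (forall x, W x -> g (f x) = x) /\ smooth_map B A (f @` W) g.

End Atlas.

#[short(type="topGroupType")]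
HB.structure Definition TopGroup := {G of Group G & Topological G}.

(* Continuity of the group operations is part of their smoothness. *)
Record lie_group (R : realType) (r : nat) (G : topGroupType) := LieGroup {
  lg_atlas :> atlas 'rV[R]_r G;
  lg_compatible : forall c d, charts lg_atlas c -> charts lg_atlas d ->
    smooth_on (cmap c @` (cdom c `&` cdom d)) (cmap d \o cinv c);
  lg_hausdorff : hausdorff_space G;
  lg_second_countable : @second_countable G;
  lg_mul_smooth : smooth_map (prod_atlas lg_atlas lg_atlas) lg_atlas setT
    (fun p : G * G => (p.1 * p.2)%g);
  lg_inv_smooth : smooth_map lg_atlas lg_atlas setT (fun g : G => (g^-1)%g) }.

Section Translations.
Context {R : realType} {r : nat} {G : topGroupType} (LG : lie_group R r G).

(* A vector field on [G]; [X g] is a tangent vector read in [chart_at LG g]. *)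
Definition vfield := G -> 'rV[R]_r.

(* [X g = d/dt (exp (t v) g)] at [t = 0]. *)
Definition inf_left_translation : set vfield :=
  [set X | exists v : 'rV[R]_r,
     forall g, X g = mdiff LG LG (fun h : G => (h * g)%g) 1%g v].

(* [X g = d/dt (g exp (t v))] at [t = 0]. *)
Definition inf_right_translation : set vfield :=
  [set X | exists v : 'rV[R]_r,
     forall g, X g = mdiff LG LG (fun h : G => (g * h)%g) 1%g v].

Definition vfield_basis (V : set vfield) (B : 'I_r -> vfield) : Prop :=
  (forall a, V (B a)) /\
  (forall X, V X -> exists! c : 'rV[R]_r,
     forall g, X g = \sum_a c 0 a *: B a g).

End Translations.

Section Jets.
Context {R : realType} {n : nat} (k : 'I_n -> nat).

(* The i-th block of coordinates of a point of J^(k_0) x ... x J^(k_(n-1)) is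
   (alpha_i, x^i_0, ..., x^i_(k_i)). *)
Definition jet_dim : nat := \sum_(i < n) (k i).+2.
Definition jet := 'rV[R]_jet_dim.

Definition alpha_ix (i : 'I_n) : 'I_jet_dim :=
  @tagnat.Rank n (fun i => (k i).+2) i ord0.
Definition x_ix (i : 'I_n) (l : 'I_(k i).+1) : 'I_jet_dim :=
  @tagnat.Rank n (fun i => (k i).+2) i (lift ord0 l).
Definition top_ix (i : 'I_n) : 'I_jet_dim := x_ix (@ord_max (k i)).

(* Derivative index of a coordinate: 0 for alpha_i, l for x^i_l. *)
Definition coord_order (c : 'I_jet_dim) : nat :=
  (@tagnat.sig2 n (fun i => (k i).+2) c).-1.

Definition jet_block (x : jet) (i : 'I_n) : 'rV[R]_(k i).+2 :=
  submxrow (q_ := fun i => (k i).+2) x i.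

Definition pd (c : 'I_jet_dim) : jet := delta_mx 0 c.

Definition total_derivative (i : 'I_n) (x : jet) : jet :=
  pd (alpha_ix i) +
  \sum_(l < k i) x 0 (x_ix (lift ord0 l)) *:
                 pd (x_ix (widen_ord (leqnSn (k i)) l)).

Definition contact (i : 'I_n) (x : jet) : {vspace jet} :=
  <<[:: total_derivative i x; pd (top_ix i)]>>%VS.

Definition multi_contact (x : jet) : {vspace jet} :=
  (\sum_(i < n) contact i x)%VS.

Definition alpha (x : jet) : 'rV[R]_n := \row_i x 0 (alpha_ix i).

Definition depends_on {F : normedModType R} {N : topologicalType}
    (B : atlas F N) (U : set jet) (f : jet -> N) (c : 'I_jet_dim) : Prop :=
  exists2 x, U x & mdiff (eucl jet) B f x (pd c) != 0.

Definition jet_order {F : normedModType R} {N : topologicalType}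
    (B : atlas F N) (U : set jet) (f : jet -> N) : nat :=
  \max_(c < jet_dim | `[< depends_on B U f c >]) coord_order c.

End Jets.
Arguments jet R {n} k.

Section Actions.
Context {R : realType} {r : nat} {G : topGroupType} (LG : lie_group R r G).
Context {n : nat} {k : 'I_n -> nat}.
Context (U : set (jet R k)) (D : set (G * jet R k)).
Context (mu : G -> jet R k -> jet R k).

(* A smooth local action on the open set [U], defined for [(g, x)] in the open
   set [D]; a global action on [U] is the case [D = setT `*` U]. *)
Record local_action : Prop := LocalAction {
  la_open : open U;
  la_dom_open : open D;
  la_dom : forall g x, D (g, x) -> U x /\ U (mu g x);
  la_dom1 : forall x, U x -> D (1%g, x);
  la_domV : forall g x, D (g, x) -> D ((g^-1)%g, mu g x);
  la_one : forall x, U x -> mu 1%g x = x;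
  la_mul : forall g h x, D (h, x) -> D (g, mu h x) -> D ((g * h)%g, x) ->
    mu (g * h)%g x = mu g (mu h x);
  la_smooth : smooth_map (prod_atlas LG (eucl (jet R k))) (eucl (jet R k)) D
    (fun p => mu p.1 p.2) }.

Record diagonal_contact : Prop := DiagonalContact {
  dc_diagonal : exists f : forall i, G -> 'rV[R]_(k i).+2 -> 'rV[R]_(k i).+2,
    forall g x, D (g, x) ->
      forall i, jet_block (mu g x) i = f i g (jet_block x i);
  dc_contact : forall g x, D (g, x) -> forall i,
    (linfun ('d (mu g) x : jet R k -> jet R k) @: contact i x)%VS =
    contact i (mu g x);
  dc_symmetry : forall g x, D (g, x) ->
    (linfun ('d (mu g) x : jet R k -> jet R k) @: multi_contact x)%VS =
    multi_contact (mu g x) }.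

Definition same_orbit : jet R k -> jet R k -> Prop :=
  clos_refl_trans _ (fun x y => exists2 g, D (g, x) & y = mu g x).

Definition free_action : Prop :=
  forall g x, D (g, x) -> mu g x = x -> g = 1%g.

Definition orbit_rank (x : jet R k) : nat :=
  \dim (limg (linfun (mdiff LG (eucl (jet R k)) (fun g => mu g x) 1%g
                        : 'rV[R]_r -> jet R k))).

(* Orbits of constant dimension, and arbitrarily small neighbourhoods meeting
   each orbit in a connected set. *)
Definition regular_action : Prop :=
  (exists d, forall x, U x -> orbit_rank x = d) /\
  (forall x, U x -> forall W, nbhs x W ->
     exists V, [/\ nbhs x V, V `<=` W, V `<=` U &
       forall y, U y -> connected (V `&` [set z | same_orbit y z])]).

Section Invariants.
Context {s : nat} (varpi : jet R k -> 'rV[R]_s) (u : jet R k -> 'rV[R]_n).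

(* Coordinates (alpha, varpi, u) on the orbit space. *)
Definition inv_space := ('rV[R]_n * 'rV[R]_s * 'rV[R]_n)%type.
Definition invariants (x : jet R k) : inv_space := (alpha x, varpi x, u x).

Record complete_invariants : Prop := CompleteInvariants {
  ci_smooth : smooth_on U invariants;
  ci_invariant : forall g x, D (g, x) -> invariants (mu g x) = invariants x;
  ci_independent : forall x, U x ->
    \dim (limg (linfun ('d invariants x : jet R k -> inv_space)))
      = (n + s + n)%N;
  ci_complete : (n + s + n + r)%N = jet_dim k;
  ci_separate : forall x y, U x -> U y ->
    invariants x = invariants y -> same_orbit x y }.

Context (frame : jet R k -> G).

Definition right_moving_frame : Prop :=
  smooth_map (eucl (jet R k)) LG U frame /\
  forall g x, D (g, x) -> frame (mu g x) = (frame x * g^-1)%g.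

Definition left_moving_frame : Prop :=
  smooth_map (eucl (jet R k)) LG U frame /\
  forall g x, D (g, x) -> frame (mu g x) = (g * frame x)%g.

Record admissible : Prop := Admissible {
  adm_free : free_action;
  adm_regular : regular_action;
  adm_alpha : forall g x, D (g, x) -> alpha (mu g x) = alpha x;
  adm_top : forall i,
    (forall x, U x -> 'D_(pd (top_ix k i)) (fun y => u y 0 i : R) x != 0) /\
    (forall j, j != i -> forall x, U x ->
       'D_(pd (top_ix k i)) (fun y => u y 0 j : R) x = 0) /\
    (forall t x, U x ->
       'D_(pd (top_ix k i)) (fun y => varpi y 0 t : R) x = 0) /\
    (forall j x, U x ->
       'D_(pd (top_ix k i)) (fun y => alpha y 0 j : R) x = 0);
  adm_order_inv : forall i,
    (jet_order (eucl 'rV[R]_n) U (@alpha R n k) < k i)%N /\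
    (jet_order (eucl 'rV[R]_s) U varpi < k i)%N;
  adm_order_frame : forall i, (jet_order LG U frame < k i)%N }.

Definition frame_atlas : atlas (inv_space * 'rV[R]_r)%type (inv_space * G)%type :=
  prod_atlas (eucl inv_space) LG.

Definition augmented_frame (x : jet R k) : inv_space * G :=
  (invariants x, frame x).

Definition frame_push (C : jet R k -> {vspace jet R k}) (x : jet R k) :
    {vspace inv_space * 'rV[R]_r} :=
  (linfun (mdiff (eucl (jet R k)) frame_atlas augmented_frame x
     : jet R k -> inv_space * 'rV[R]_r) @: C x)%VS.

End Invariants.
End Actions.
Arguments inv_space R n s : clear implicits.
Arguments complete_invariants {R} r {G n k} U D mu {s} varpi u.
Arguments frame_atlas {R r G} LG n s.

(* The fibre at (q, g) of
   { d/d alpha_j + h_j(q) . d/d varpi + kk_j(q) . L(g), d/d u_j }. *)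
Definition reduced_summand {R : realType} {r : nat} {G : topGroupType}
    {n s : nat} (h : 'I_n -> inv_space R n s -> 'rV[R]_s)
    (kk : 'I_n -> inv_space R n s -> 'rV[R]_r) (L : 'I_r -> @vfield R r G)
    (p : inv_space R n s * G) (j : 'I_n) :
    {vspace inv_space R n s * 'rV[R]_r} :=
  let w1 : inv_space R n s * 'rV[R]_r :=
    ((delta_mx 0 j, h j p.1, 0), \sum_(a < r) kk j p.1 0 a *: L a p.2) in
  let w2 : inv_space R n s * 'rV[R]_r := ((0, 0, delta_mx 0 j), 0) in
  <<[:: w1; w2]>>%VS.

(* Main.v *)
Require Import Defs.
From HB Require Import structures.
From mathcomp Require Import all_boot all_order all_algebra.
From mathcomp Require Import all_classical all_reals all_analysis.

Set Implicit Arguments.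
Unset Strict Implicit.
Unset Printing Implicit Defensive.

Import Order.TTheory GRing.Theory Num.Theory.
Import numFieldNormedType.Exports.
Local Open Scope classical_set_scope.
Local Open Scope ring_scope.

(** The two halves of the theorem are one statement. The frame [rho] changes
    under the action by right translations, which commute with left translations
    and so preserve the infinitesimal left translations; the frame [lambda]
    changes by left translations, which preserve the infinitesimal right
    translations. Writing [theta p h] for [h p] in the first case and [p h] in
    the second, [frame (g x) = theta (e g) (frame x)] with [e g] equal to [g^-1]
    or [g], and the fields are the derivatives at [h = 1] of [theta p h]. The
    argument rests on the laws common to the group product and its opposite
    ([translation_law]).

    Let [D_i] be the i-th total derivative and [T_i] the derivative in the i-th
    coordinate of highest order. By admissibility [T_i] kills the alphas, the
    varpis and the frame, and its only nonzero derivative of an invariant is that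
    of [u_i], so its image is a nonzero multiple of [d/du_i].
    Since the action preserves each contact factor and the alphas, it maps [D_i] to
    [D_i + b T_i] for some [b] ([diff_action_total_derivative]). Consequently:
    the derivative of varpi along [D_i] is invariant ([diff_varpi_invariant]), and so
    are the coefficients, in a basis of infinitesimal translations, of the
    derivative of the frame along [D_i] ([frame_coord_invariant]); these fields
    do form a basis of each tangent space of the group ([vfield_mx_unit]).
    Modulo the [d/du_j] the image of [D_i] is therefore
    [d/dalpha_i + h_i . d/dvarpi + k_i . L] with [h_i] and [k_i] invariant.

    Invariant functions factor through the invariants, which separate orbits.
    They are smooth on the quotient because the inverse of the augmented moving
    frame, restricted to a level set of the group component, is a smooth local
    section of the invariants ([moving_frame_section]); as the frame is constant
    along it, one chart of the group and one translation serve for all its points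
    ([descend_smooth]). *)

(** * Smooth maps between normed spaces *)

Section Differential.
Context {R : realType}.

(** Charts only describe a map near a point, so that differentials have to be
    compared along germs of functions. *)
Lemma near_eq_diff (E F : normedModType R) (f g : E -> F) (x : E) :
  {near x, f =1 g} -> differentiable f x ->
  differentiable g x /\ 'd g x = 'd f x :> (E -> F).
Proof.
move=> fg df.
have fgx : f x = g x := nbhs_singleton fg.
have [dfc dfx] := (diff_locallyP x f).1 df.
have gE : g \o shift x = cst (g x) + 'd f x +o_ 0 id.
  apply/eqaddoP => _/posnumP[e].
  have /eqaddoP/(_ e%:num (gt0 _)) := dfx.
  have : \forall h \near 0, f (h + x) = g (h + x).
    by have := fg; rewrite (near_shift 0 x) /= => H; near=> h;
      rewrite -[x]subr0; near: h.
  apply: filterS2 => h fgh; congr (_ <= _).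
  by rewrite !fctE /= fgh fgx.
have dgE := diff_unique dfc gE.
split; last exact: dgE.
by apply/diff_locallyP; rewrite dgE; split=> //; exact: gE.
Unshelve. all: by end_near. Qed.

Lemma linear_addZ (E F : lmodType R) (f : {linear E -> F}) a b w :
  f w = 0 -> f (a + b *: w) = f a.
Proof. by move=> fw0; rewrite linearD linearZ fw0 /= scaler0 addr0. Qed.

Lemma diff_linear_comp (E F F' : normedModType R) (L : {linear F -> F'})
    (f : E -> F) (x v : E) :
  continuous L -> differentiable f x ->
  'd (L \o f) x v = L ('d f x v).
Proof.
move=> Lc df; rewrite diff_comp //=; last exact: linear_differentiable.
by rewrite diff_lin.
Qed.

Definition row_coord N (j : 'I_N) (x : 'rV[R]_N) : R := x 0 j.

Fact row_coord_linear N (j : 'I_N) : linear (row_coord j).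
Proof. by move=> a x y; rewrite /row_coord !mxE. Qed.

HB.instance Definition _ N (j : 'I_N) :=
  GRing.isLinear.Build R 'rV[R]_N R _ (row_coord j) (row_coord_linear j).

Lemma row_coord_continuous N (j : 'I_N) : continuous (row_coord j).
Proof. exact: coord_continuous. Qed.

Lemma diff_coord (E : normedModType R) N (f : E -> 'rV[R]_N) x v j :
  differentiable f x -> 'd f x v 0 j = 'D_v (fun y => f y 0 j : R) x.
Proof.
move=> df; have dfc : differentiable (row_coord j \o f) x.
  apply: differentiable_comp => //; apply: linear_differentiable.
  exact: row_coord_continuous.
rewrite deriveE //.
exact: (esym (diff_linear_comp v (@row_coord_continuous N j) df)).
Qed.

Lemma diff_row_sum N (F : normedModType R) (f : 'rV[R]_N -> F) x v :
  'd f x v = \sum_(i < N) v 0 i *: 'd f x (delta_mx 0 i).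
Proof.
rewrite [in LHS](row_sum_delta v) linear_sum; apply: eq_bigr => i _.
by rewrite linearZ.
Qed.

Lemma differentiable_scale (E F : normedModType R) (a : E -> R) (f : E -> F) x :
  differentiable a x -> differentiable f x ->
  differentiable (fun y => a y *: f y) x /\
  forall v, 'd (fun y => a y *: f y) x v = 'd a x v *: f x + a x *: 'd f x v.
Proof.
move=> da df.
have bl : bilinear_for (GRing.Scale.Law.clone _ _ *:%R _)
     (GRing.Scale.Law.clone _ _ *:%R _) (fun (c : R) (w : F) => c *: w).
  split=> [w k c d|c k w z] /=; first by rewrite scalerDl scalerA.
  by rewrite scalerDr !scalerA mulrC.
pose bM := bilinear_isBilinear.Build R R F F _ _ _ bl.
pose B : {bilinear R -> F -> F} := HB.pack (fun (c : R) (w : F) => c *: w) bM.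
have Bc : continuous (fun p => B p.1 p.2).
  exact: (@scale_continuous R F).
have dB := @differentiable_bilin R R F F B (a x, f x) Bc.
have dBE := @diff_bilin R R F F B (a x, f x) Bc.
have dp : differentiable (fun y => (a y, f y)) x by exact: differentiable_pair.
have dE := @diff_comp R E _ F _ _ x dp dB.
split; first exact: (@differentiable_comp R E _ F _ _ x dp dB).
move=> v; have /= -> := congr1 (@^~ v) dE.
by rewrite dBE diff_pair // addrC.
Qed.

End Differential.

Section SmoothMaps.
Context {R : realType}.
Implicit Types E F : normedModType R.

Lemma Cn_onW E F n (A : set E) (f : E -> F) : Cn_on n.+1 A f -> Cn_on n A f.
Proof.
elim: n f => [|n IH] f [df Df]; first by move=> x /df /differentiable_continuous.
by split=> // v; apply: IH; exact: Df.
Qed.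

Lemma Cn_on_sub E F n (A B : set E) (f : E -> F) :
  B `<=` A -> Cn_on n A f -> Cn_on n B f.
Proof.
move=> BA; elim: n f => [|n IH] f; first by move=> fc x /BA /fc.
by move=> [df Df]; split=> [x /BA /df //|v]; exact: IH (Df v).
Qed.

(** Smoothness being a condition at each point, it can be checked on a
    neighbourhood chosen for that point. *)
Lemma Cn_on_local E F n (A : set E) (f : E -> F) :
  (forall x, A x -> exists2 B : set E, B x & Cn_on n B f) -> Cn_on n A f.
Proof.
elim: n f => [|n IH] f H.
  move=> x /H[B Bx fc]; exact: (fc x Bx).
split=> [x /H[B Bx [df _]]|v]; first exact: df.
by apply: IH => x /H[B Bx [_ Df]]; exists B => //; exact: Df.
Qed.

Lemma Cn_on_ext E F n (A : set E) (f g : E -> F) : open A ->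
  (forall x, A x -> f x = g x) -> Cn_on n A f -> Cn_on n A g.
Proof.
move=> oA; elim: n f g => [|n IH] f g fg.
  move=> fc x Ax; change (g @ x --> g x); rewrite -(fg x Ax).
  apply: cvg_trans (fc x Ax); apply: near_eq_cvg.
  by apply: filterS (open_nbhs_nbhs (conj oA Ax)) => y Ay; exact: fg.
move=> [df Df].
have nfg x : A x -> \forall y \near x, f y = g y.
  move=> Ax; apply: filterS (open_nbhs_nbhs (conj oA Ax)) => y.
  exact: fg.
split=> [x Ax|v]; first by have [] := near_eq_diff (nfg x Ax) (df x Ax).
apply: IH (Df v) => x Ax.
by apply: near_eq_derive; exact: nfg.
Qed.

Lemma Cn_on_cst E F n (A : set E) (c : F) : Cn_on n A (cst c).
Proof.
elim: n c => [|n IH] c; first by move=> x _; exact: cst_continuous.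
split=> [x _|v]; first exact: differentiable_cst.
by rewrite (_ : (fun x => _) = cst 0) //; apply/funext => x; exact: derive_cst.
Qed.

Lemma Cn_on_linear E F n (A : set E) (L : {linear E -> F}) :
  continuous L -> Cn_on n A L.
Proof.
move=> Lc; case: n => [|n]; first by move=> x _; exact: Lc.
split=> [x _|v]; first exact: linear_differentiable.
rewrite (_ : (fun x => _) = cst (L v)); first exact: Cn_on_cst.
apply/funext => x; rewrite deriveE; last exact: linear_differentiable.
by rewrite diff_lin.
Qed.

Lemma Cn_on_comp_linear E F F' n (A : set E) (f : E -> F)
    (L : {linear F -> F'}) :
  open A -> continuous L -> Cn_on n A f -> Cn_on n A (L \o f).
Proof.
move=> oA Lc; elim: n f => [|n IH] f.
  by move=> fc x Ax; apply: continuous_comp; [exact: fc|exact: Lc].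
move=> [df Df]; have dLf x : A x -> differentiable (L \o f) x.
  by move=> Ax; apply: differentiable_comp; [exact: df|exact: linear_differentiable].
split=> // v; apply: Cn_on_ext (IH _ (Df v)) => // x Ax /=.
by rewrite !deriveE; [rewrite diff_linear_comp|exact: dLf|]; rewrite //; exact: df.
Qed.

Lemma Cn_on_add E F n (A : set E) (f g : E -> F) : open A ->
  Cn_on n A f -> Cn_on n A g -> Cn_on n A (fun x => f x + g x).
Proof.
move=> oA; elim: n f g => [|n IH] f g.
  by move=> fc gc x Ax; apply: continuousD; [exact: fc|exact: gc].
move=> [df Df] [dg Dg]; split=> [x Ax|v].
  by apply: differentiableD; [exact: df|exact: dg].
apply: Cn_on_ext (IH _ _ (Df v) (Dg v)) => // x Ax.
by rewrite -deriveD //; apply: diff_derivable; [exact: df|exact: dg].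
Qed.

Lemma Cn_on_sum E F n (I : Type) (s : seq I) (A : set E) (f : I -> E -> F) :
  open A -> (forall i, Cn_on n A (f i)) ->
  Cn_on n A (fun x => \sum_(i <- s) f i x).
Proof.
move=> oA fs; elim: s => [|i s IH].
  have -> : (fun x => \sum_(i <- [::]) f i x) = cst 0 :> (E -> F).
    by apply/funext => x; rewrite big_nil.
  exact: Cn_on_cst.
have -> : (fun x => \sum_(j <- i :: s) f j x) =
    (fun x => f i x + \sum_(j <- s) f j x) :> (E -> F).
  by apply/funext => x; rewrite big_cons.
exact: Cn_on_add.
Qed.

Lemma Cn_on_scale E F n (A : set E) (a : E -> R) (f : E -> F) : open A ->
  Cn_on n A a -> Cn_on n A f -> Cn_on n A (fun x => a x *: f x).
Proof.
move=> oA; elim: n a f => [|n IH] a f.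
  by move=> ac fc x Ax; apply: continuousZ; [exact: ac|exact: fc].
move=> Sa Sf; have [[da Da] [df Df]] := (Sa, Sf).
have daf x (Ax : A x) := differentiable_scale (da x Ax) (df x Ax).
split=> [x /daf[]//|v].
have := Cn_on_add oA (IH _ _ (Da v) (Cn_onW Sf)) (IH _ _ (Cn_onW Sa) (Df v)).
apply: Cn_on_ext => // x Ax.
have [d dE] := daf x Ax; rewrite [RHS]deriveE // dE -!deriveE //.
  exact: df.
exact: da.
Qed.

Lemma Cn_on_coord n N (A : set 'rV[R]_N) (i : 'I_N) :
  Cn_on n A (fun x : 'rV[R]_N => x 0 i : R).
Proof. exact: (Cn_on_linear n A (@row_coord_continuous R N i)). Qed.

Lemma Cn_on_comp_coord E n N (A : set E) (g : E -> 'rV[R]_N) (i : 'I_N) :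
  open A -> Cn_on n A g -> Cn_on n A (fun x => g x 0 i : R).
Proof.
move=> oA; exact: (Cn_on_comp_linear oA (@row_coord_continuous R N i)).
Qed.

(** The inner map takes values in coordinates, so that by the chain rule
    [D_v (f o g) = sum_i (D_v g)_i D_i f o g]: each term is one order less
    smooth, and the induction on the order closes for all [f] and [g] at once. *)
Lemma Cn_on_comp E F n N (A : set E) (B : set 'rV[R]_N) (f : 'rV[R]_N -> F)
    (g : E -> 'rV[R]_N) : open A -> (forall x, A x -> B (g x)) ->
  Cn_on n B f -> Cn_on n A g -> Cn_on n A (f \o g).
Proof.
move=> oA AB; elim: n f g AB => [|n IH] f g AB.
  by move=> fc gc x Ax; apply: continuous_comp; [exact: gc|apply: fc; exact: AB].
move=> Sf Sg; have [[df Df] [dg Dg]] := (Sf, Sg).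
have dfg x : A x -> differentiable (f \o g) x.
  by move=> Ax; apply: differentiable_comp; [exact: dg|apply: df; exact: AB].
split=> // v.
have S i : Cn_on n A (fun x => ('D_v g x) 0 i *:
    ((fun y => 'D_(delta_mx 0 i) f y) \o g) x).
  apply: Cn_on_scale => //.
    exact: (Cn_on_comp_coord i oA (Dg v)).
  by apply: (IH _ _ AB _ (Cn_onW Sg)); exact: Df.
apply: Cn_on_ext (Cn_on_sum (index_enum _) oA S) => // x Ax.
have [dgx dfgx] := (dg _ Ax, df _ (AB _ Ax)).
rewrite [RHS]deriveE; last exact: dfg.
rewrite diff_comp //= diff_row_sum; apply: eq_bigr => i _.
by rewrite !deriveE.
Qed.

(** Freezing one component of a map on a product amounts to composing with an
    affine map; the domain is then an arbitrary normed space. *)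
Lemma Cn_on_comp_affine E E' F n (A : set E) (B : set E') (f : E' -> F)
    (c : E') (L : {linear E -> E'}) : continuous L ->
  (forall x, A x -> B (L x + c)) -> Cn_on n B f ->
  Cn_on n A (fun x => f (L x + c)).
Proof.
move=> Lc AB; elim: n f => [|n IH] f.
  move=> fc x Ax; apply: (@continuous_comp _ _ _ (fun x => L x + c) f).
    by apply: continuousD; [exact: Lc|exact: cst_continuous].
  by apply: fc; exact: AB.
move=> [df Df]; split=> [x Ax|v].
  apply: (@differentiable_comp _ _ _ _ (fun x => L x + c) f).
    apply: differentiableD; last exact: differentiable_cst.
    exact: linear_differentiable.
  by apply: df; exact: AB.
rewrite (_ : (fun x => _) = fun x => 'D_(L v) f (L x + c)).
  exact: IH (Df _).
apply/funext => x; apply: (congr1 (fun g : R -> F => lim (g @ 0^'))).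
by apply/funext => h; rewrite /= linearP addrA.
Qed.

Lemma Cn_on_diff_field F n N (A : set 'rV[R]_N) (f : 'rV[R]_N -> F)
    (X : 'rV[R]_N -> 'rV[R]_N) : open A ->
  Cn_on n.+1 A f -> Cn_on n A X -> Cn_on n A (fun x => 'd f x (X x)).
Proof.
move=> oA [df Df] SX.
have S i : Cn_on n A (fun x => X x 0 i *: 'D_(delta_mx 0 i) f x).
  by apply: Cn_on_scale (Df _) => //; exact: (Cn_on_comp_coord i oA SX).
apply: Cn_on_ext (Cn_on_sum (index_enum _) oA S) => // x Ax.
rewrite diff_row_sum; apply: eq_bigr => i _; rewrite deriveE //; exact: df.
Qed.

End SmoothMaps.

(** * Differentials on manifolds *)

Section Manifold.
Context {R : realType}.

(** Continuity is required separately: differentiability of the chart expression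
    constrains [f] only at points that [f] sends into the target chart. *)
Definition mdifferentiable {E F : normedModType R} {M N : topologicalType}
    (A : atlas E M) (B : atlas F N) (f : M -> N) (p : M) : Prop :=
  {for p, continuous f} /\
  differentiable (cmap (chart_at B (f p)) \o f \o cinv (chart_at A p))
    (cmap (chart_at A p) p).

Section Charts.
Context {E : normedModType R} {M : topologicalType} (A : atlas E M) (p : M).

Lemma near_chart_dom : \forall q \near p, cdom (chart_at A p) q.
Proof.
by apply: open_nbhs_nbhs; split; [exact: cdom_open|exact: chart_at_dom].
Qed.

Lemma chart_atK : cinv (chart_at A p) (cmap (chart_at A p) p) = p.
Proof. by apply: cmapK; exact: chart_at_dom. Qed.

Lemma chart_at_image :
  (cmap (chart_at A p) @` cdom (chart_at A p)) (cmap (chart_at A p) p).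
Proof. by exists p => //; exact: chart_at_dom. Qed.

Lemma cvg_cinv_chart_at : cinv (chart_at A p) @ cmap (chart_at A p) p --> p.
Proof.
have : cinv (chart_at A p) @ cmap (chart_at A p) p -->
    cinv (chart_at A p) (cmap (chart_at A p) p).
  exact: cinv_continuous chart_at_image.
by rewrite chart_atK.
Qed.

Lemma near_cmapK : \forall t \near cmap (chart_at A p) p,
  cmap (chart_at A p) (cinv (chart_at A p) t) = t.
Proof.
apply: filterS (open_nbhs_nbhs (conj (@cimg_open _ _ _ _) chart_at_image)).
by move=> _ [q dq <-]; rewrite cmapK.
Qed.

End Charts.

Section Maps.
Context {E F : normedModType R} {M N : topologicalType}.
Context (A : atlas E M) (B : atlas F N).

Lemma smooth_map_mdifferentiable U (f : M -> N) p :
  smooth_map A B U f -> U p -> mdifferentiable A B f p.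
Proof.
move=> [fc fs] Up; split; first exact: fc.
have [df _] := fs _ _ (chart_at_charts A p) (chart_at_charts B (f p)) 1%N.
by apply: df; exists p => //; split; [split=> //|]; exact: chart_at_dom.
Qed.

Lemma near_eq_mdiff (f g : M -> N) p : {near p, f =1 g} ->
  mdifferentiable A B f p ->
  mdifferentiable A B g p /\ mdiff A B g p = mdiff A B f p :> (E -> F).
Proof.
move=> fg [fc df]; have fgp : f p = g p := nbhs_singleton fg.
have fg' : {near cmap (chart_at A p) p,
    cmap (chart_at B (g p)) \o f \o cinv (chart_at A p) =1
    cmap (chart_at B (g p)) \o g \o cinv (chart_at A p)}.
  have := @cvg_cinv_chart_at _ _ A p _ fg.
  by rewrite nbhs_simpl /=; apply: filterS => t /= ->.
rewrite /mdifferentiable /mdiff; rewrite fgp in df *.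
have [dg dgE] := near_eq_diff fg' df.
split=> //; split=> //; change (g @ p --> g p); rewrite -fgp.
by apply: cvg_trans fc; exact: near_eq_cvg.
Qed.

Lemma mdifferentiable_cst (q : N) p : mdifferentiable A B (cst q) p.
Proof.
split; first exact: cst_continuous.
exact: (differentiable_cst (cmap (chart_at B q) q)).
Qed.

End Maps.

Lemma mdifferentiable_id {E : normedModType R} {M : topologicalType}
    (A : atlas E M) p :
  mdifferentiable A A id p /\ mdiff A A id p = id :> (E -> E).
Proof.
have idE : {near cmap (chart_at A p) p,
    id =1 cmap (chart_at A p) \o id \o cinv (chart_at A p)}.
  by apply: filterS (near_cmapK A p) => t /= ->.
have di : differentiable (@id E) (cmap (chart_at A p) p) by [].
have [d dE] := near_eq_diff idE di.
split; first by split=> //; exact: cvg_id.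
by rewrite /mdiff dE; apply: diff_val.
Qed.

Lemma mdiff_comp {E F H : normedModType R} {M N P : topologicalType}
    (A : atlas E M) (B : atlas F N) (C : atlas H P) (f : M -> N) (g : N -> P) p :
  mdifferentiable A B f p -> mdifferentiable B C g (f p) ->
  mdifferentiable A C (g \o f) p /\
  mdiff A C (g \o f) p = mdiff B C g (f p) \o mdiff A B f p :> (E -> H).
Proof.
move=> [fc df] [gc dg].
set a := chart_at A p; set b := chart_at B (f p); set c := chart_at C (g (f p)).
set f' := cmap b \o f \o cinv a; set g' := cmap c \o g \o cinv b.
have f'E : f' (cmap a p) = cmap b (f p) by rewrite /f' /= chart_atK.
have fgE : {near cmap a p, g' \o f' =1 cmap c \o (g \o f) \o cinv a}.
  have bnear : \forall t \near cmap a p, cdom b (f (cinv a t)).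
    exact: (@cvg_cinv_chart_at _ _ A p _ (fc _ (near_chart_dom B (f p)))).
  apply: filterS bnear => t /= bt.
  by rewrite /g' /f' /= cmapK.
have dg' : differentiable g' (f' (cmap a p)) by rewrite f'E.
have [d dE] := near_eq_diff fgE (differentiable_comp df dg').
split; first by split=> //; exact: continuous_comp.
by rewrite /mdiff dE diff_comp // f'E.
Qed.

Lemma mdiff_pair {E F H : normedModType R} {M N P : topologicalType}
    (A : atlas E M) (B : atlas F N) (C : atlas H P) (f : M -> N) (g : M -> P) p :
  mdifferentiable A B f p -> mdifferentiable A C g p ->
  mdifferentiable A (prod_atlas B C) (fun x => (f x, g x)) p /\
  mdiff A (prod_atlas B C) (fun x => (f x, g x)) p =
    (fun v => (mdiff A B f p v, mdiff A C g p v)) :> (E -> F * H).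
Proof.
move=> [fc df] [gc dg]; split; last exact: diff_pair df dg.
split; first exact: cvg_pair fc gc.
exact: differentiable_pair df dg.
Qed.

Lemma mdifferentiable_eucl (E F : normedModType R) (f : E -> F) x :
  differentiable f x <-> mdifferentiable (eucl E) (eucl F) f x.
Proof.
by split=> [df|[]//]; split=> //; exact: differentiable_continuous.
Qed.

End Manifold.

(** * Translations of a Lie group *)

Section GroupTranslations.
Context {R : realType} {r : nat} {G : topGroupType} (LG : lie_group R r G).

(** The properties shared by the group law and its opposite: left and right
    translations are treated at once by reasoning with an arbitrary [theta]. *)
Record translation_law (theta : G -> G -> G) : Prop := TranslationLaw {
  tl_diff : forall p h, mdifferentiable LG LG (theta p) h;
  tl_1l : forall h, theta 1%g h = h;
  tl_1r : forall p, theta p 1%g = p;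
  tl_assoc : forall a p h, theta a (theta p h) = theta (theta a p) h;
  tl_inv : forall p, theta (p^-1)%g p = 1%g }.

Lemma mulg_mdifferentiable (f1 f2 : G -> G) h :
  mdifferentiable LG LG f1 h -> mdifferentiable LG LG f2 h ->
  mdifferentiable LG LG (fun q => (f1 q * f2 q)%g) h.
Proof.
move=> d1 d2; have [d12 _] := mdiff_pair d1 d2.
have dm := smooth_map_mdifferentiable (lg_mul_smooth LG) (I : setT (f1 h, f2 h)).
exact: (mdiff_comp d12 dm).1.
Qed.

Lemma left_mul_law : translation_law (fun p h => (p * h)%g).
Proof.
split=> [p h|h|p|a p h|p]; rewrite ?mul1g ?mulg1 ?mulgA ?mulVg //.
apply: mulg_mdifferentiable; last exact: (mdifferentiable_id LG h).1.
exact: mdifferentiable_cst.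
Qed.

Lemma right_mul_law : translation_law (fun p h => (h * p)%g).
Proof.
split=> [p h|h|p|a p h|p]; rewrite ?mul1g ?mulg1 ?mulgA ?mulgV //.
apply: mulg_mdifferentiable; first exact: (mdifferentiable_id LG h).1.
exact: mdifferentiable_cst.
Qed.

Context (theta : G -> G -> G) (law : translation_law theta).

(** The field obtained by transporting a tangent vector at the identity with the
    translations: an infinitesimal translation of [G]. *)
Definition spread (v : 'rV[R]_r) : @vfield R r G :=
  fun g => mdiff LG LG (theta g) 1%g v.

(** Associativity says that translating by [a] after translating by [p] is
    translating by [theta a p]; this is its derivative at the identity. *)
Lemma spread_equivariant v a p :
  mdiff LG LG (theta a) p (spread v p) = spread v (theta a p).
Proof.
have da := tl_diff law a (theta p 1%g).
have d := (mdiff_comp (tl_diff law p 1%g) da).2.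
have aE : theta a \o theta p = theta (theta a p).
  by apply/funext => h; exact: tl_assoc law _ _ _.
transitivity (mdiff LG LG (theta a) (theta p 1%g) (mdiff LG LG (theta p) 1%g v)).
  by rewrite (tl_1r law).
by rewrite /spread -aE; exact: esym (congr1 (@^~ v) d).
Qed.

Lemma spread1 v : spread v 1%g = v.
Proof.
rewrite /spread (_ : theta 1%g = id); last by apply/funext => h; exact: tl_1l.
by rewrite (mdifferentiable_id LG 1%g).2.
Qed.

Lemma spread_inj p v : spread v p = 0 -> v = 0.
Proof.
by move=> v0; rewrite -(spread1 v) -(tl_inv law p) -spread_equivariant v0 linear0.
Qed.

Definition vfield_mx (L : 'I_r -> @vfield R r G) (p : G) : 'M[R]_r :=
  \matrix_a L a p.

Context (L : 'I_r -> @vfield R r G) (L_basis : vfield_basis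
  [set X | exists v, forall g, X g = mdiff LG LG (theta g) 1%g v] L).

Lemma basis_equivariant a b p :
  mdiff LG LG (theta a) p (L b p) = L b (theta a p).
Proof.
by have [v Lv] := L_basis.1 b; rewrite !Lv; exact: spread_equivariant.
Qed.

(** A basis of the Lie algebra of infinitesimal translations is a frame of [G]:
    at the identity its values span the tangent space, since every tangent
    vector there extends to such a field, and translations transport a basis of
    the tangent space at the identity to one at [p]. *)
Lemma vfield_mx_unit p : vfield_mx L p \in unitmx.
Proof.
rewrite -row_free_unit; apply/row_freeP.
have /choice[v Lv] : forall b, exists v, forall g, L b g = spread v g.
  by move=> b; exact: L_basis.1.
have spanE w : exists c : 'rV[R]_r, w = c *m \matrix_b v b.
  have [|c [cE _]] := L_basis.2 (spread w); first by exists w.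
  exists c; have := cE 1%g; rewrite spread1 => ->.
  rewrite mulmx_sum_row; apply: eq_bigr => b _.
  by rewrite rowK Lv spread1.
have Vunit : \matrix_b v b \in unitmx.
  have /choice[c cE] := fun i : 'I_r => spanE (delta_mx 0 i).
  have /mulmx1_unit[//] : (\matrix_i c i) *m (\matrix_b v b) = 1%:M.
  by apply/row_matrixP => i; rewrite row_mul rowK -cE row1.
have -> : vfield_mx L p =
    (\matrix_b v b) *m lin1_mx (mdiff LG LG (theta p) 1%g).
  by apply/row_matrixP => b; rewrite row_mul !rowK mul_rV_lin1 Lv.
exists (invmx ((\matrix_b v b) *m lin1_mx (mdiff LG LG (theta p) 1%g))).
apply: mulmxV; rewrite unitmx_mul Vunit /= -row_free_unit -kermx_eq0.
apply/rowV0P => w /sub_kermxP; rewrite mul_rV_lin1; exact: spread_inj.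
Qed.

End GroupTranslations.

(** * The contact distribution and the reduced distribution *)

Section JetAlgebra.
Context {R : realType} {n : nat} (k : 'I_n -> nat).

Lemma coord_order_top i : coord_order (top_ix k i) = k i.
Proof.
by rewrite /coord_order /top_ix /x_ix tagnat.Rank2K.
Qed.

Lemma alpha_ix_eq i j : (alpha_ix k i == alpha_ix k j) = (i == j).
Proof. by rewrite -val_eqE /= tagnat.eq_Rank eqxx andbT. Qed.

Lemma alpha_ix_x i j (l : 'I_(k j).+1) : (alpha_ix k i == x_ix l) = false.
Proof. by rewrite -val_eqE /= tagnat.eq_Rank andbC. Qed.

Lemma alpha_total_derivative i (x : jet R k) :
  alpha (total_derivative i x) = delta_mx 0 i.
Proof.
apply/rowP => j; rewrite !mxE alpha_ix_eq /= summxE big1 ?addr0 1?eq_sym //.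
by move=> l _; rewrite !mxE alpha_ix_x andbF mulr0.
Qed.

Lemma alpha_pd_top i : alpha (pd (top_ix k i) : jet R k) = 0.
Proof. by apply/rowP => j; rewrite !mxE /top_ix alpha_ix_x andbF. Qed.

Lemma contactP i (x w : jet R k) : w \in contact i x ->
  exists a b, w = a *: total_derivative i x + b *: pd (top_ix k i).
Proof.
rewrite /contact span_cons span_seq1 => /memv_addP[_ /vlineP[a ->]].
by move=> [_ /vlineP[b ->]] ->; exists a, b.
Qed.

Lemma Cn_on_total_derivative m i (A : set (jet R k)) : open A ->
  Cn_on m A (@total_derivative R n k i).
Proof.
move=> oA; apply: Cn_on_add => //; first exact: Cn_on_cst.
apply: Cn_on_sum => // l; apply: Cn_on_scale => //; first exact: Cn_on_coord.
exact: Cn_on_cst.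
Qed.

End JetAlgebra.

Section Summands.
Context {R : realType} {r n s : nat} {G : topGroupType}.
Context (h : 'I_n -> inv_space R n s -> 'rV[R]_s)
  (kk : 'I_n -> inv_space R n s -> 'rV[R]_r) (L : 'I_r -> @vfield R r G).

Lemma reduced_summandP p j w : w \in reduced_summand h kk L p j ->
  exists a b,
    w = a *: (((delta_mx 0 j, h j p.1, 0), \sum_(c < r) kk j p.1 0 c *: L c p.2)
        : inv_space R n s * 'rV[R]_r)
      + b *: (((0, 0, delta_mx 0 j), 0) : inv_space R n s * 'rV[R]_r).
Proof.
rewrite /reduced_summand span_cons span_seq1 => /memv_addP[_ /vlineP[a ->]].
by move=> [_ /vlineP[b ->]] ->; exists a, b.
Qed.

(** The components along the alphas and along the u's of a combination of the
    generators are its coefficients. *)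
Lemma directv_reduced_summand p :
  directv (\sum_(j < n) reduced_summand h kk L p j)%VS.
Proof.
apply/directv_sum_independent => w wP w0 j _.
have /choice[a /choice[b wE]] := fun j => reduced_summandP (wP j isT).
have aE : \sum_j (w j).1.1.1 = 0 by rewrite -!raddf_sum w0.
have bE : \sum_j (w j).1.2 = 0 by rewrite -!raddf_sum w0.
have a0 : a j = 0.
  have := congr1 (fun v : 'rV[R]_n => v 0 j) aE.
  rewrite summxE (bigD1 j) //= big1 => [|l lj]; rewrite wE /= !mxE.
    by rewrite !eqxx /= mulr1 mulr0 !addr0.
  by rewrite eqxx eq_sym (negPf lj) !mulr0 addr0.
have b0 : b j = 0.
  have := congr1 (fun v : 'rV[R]_n => v 0 j) bE.
  rewrite summxE (bigD1 j) //= big1 => [|l lj]; rewrite wE /= !mxE.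
    by rewrite !eqxx /= mulr1 mulr0 add0r addr0.
  by rewrite eqxx eq_sym (negPf lj) !mulr0 addr0.
by rewrite wE a0 b0 !scale0r addr0.
Qed.

End Summands.

(** * Functions on the orbit space *)

Lemma continuous_pair_cst (T T' : topologicalType) (c : T') :
  continuous (fun x : T => (x, c)).
Proof.
move=> x; have idc : (fun y : T => y) @ x --> x by exact: cvg_id.
have cstc : (fun y : T => c) @ x --> c by exact: cvg_cst.
exact: cvg_pair idc cstc.
Qed.

Lemma continuous_cst_pair (T T' : topologicalType) (c : T') :
  continuous (fun x : T => (c, x)).
Proof.
move=> x; have idc : (fun y : T => y) @ x --> x by exact: cvg_id.
have cstc : (fun y : T => c) @ x --> c by exact: cvg_cst.
exact: cvg_pair cstc idc.
Qed.

Section Descent.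
Context {R : realType} {r : nat} {G : topGroupType} (LG : lie_group R r G).
Context {n : nat} {k : 'I_n -> nat} (U : set (jet R k)).
Context {s : nat} (varpi : jet R k -> 'rV[R]_s) (u : jet R k -> 'rV[R]_n).
Context (frame : jet R k -> G)
  (phi_diffeo : local_diffeo (eucl (jet R k)) (frame_atlas LG n s) U
    (augmented_frame varpi u frame)).

(** The inverse of the augmented moving frame, with the group component frozen at
    the value it takes at [x0], is a smooth local section of the invariants. The
    moving frame is constant along it, so that one chart of [G] and one
    translation serve on its whole image. *)
Lemma moving_frame_section x0 : U x0 ->
  exists (Q : set (inv_space R n s)) (sigma : inv_space R n s -> jet R k),
  [/\ open Q, Q (invariants varpi u x0), sigma (invariants varpi u x0) = x0,
      smooth_on Q sigma &
      forall q, Q q -> [/\ U (sigma q), invariants varpi u (sigma q) = q &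
        frame (sigma q) = frame x0]].
Proof.
move=> Ux0; have [_ /(_ x0 Ux0)[W [g [[oW Wx0 WU oB] [gK gs]]]]] := phi_diffeo.
pose g0 := frame x0; pose c0 := chart_at LG g0.
pose phi := augmented_frame varpi u frame.
pose Q := [set q | (phi @` W) (q, g0)].
pose sigma q := g (q, g0).
have oQ : open Q.
  apply: (@open_comp _ _ (fun q : inv_space R n s => (q, g0)) (phi @` W)) oB.
  by move=> q _; exact: continuous_pair_cst.
exists Q, sigma; split=> //.
- by exists x0.
- by rewrite /sigma -[(_, _)]/(phi x0) gK.
- move=> m; pose c := prod_chart (eucl_chart (inv_space R n s)) c0.
  have cc : charts (frame_atlas LG n s) c.
    by exists (eucl_chart _) => //; exists c0 => //; exact: chart_at_charts.
  have := gs.2 c (eucl_chart (jet R k)) cc erefl m.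
  pose L (q : inv_space R n s) : inv_space R n s * 'rV[R]_r := (q, 0).
  have Llin : linear L by move=> a p q; congr (_, _); rewrite /= scaler0 addr0.
  pose LM := GRing.isLinear.Build _ _ _ _ _ Llin.
  pose LL : {linear (inv_space R n s) -> (inv_space R n s * 'rV[R]_r)%type} :=
    HB.pack L LM.
  have LLc : continuous LL.
    exact: (@continuous_pair_cst (inv_space R n s) _ (0 : 'rV[R]_r)).
  have LE q : LL q + (0, cmap c0 g0) = (q, cmap c0 g0).
    by congr (_, _); rewrite /= ?addr0 ?add0r.
  have sE q : g (cinv c (LL q + (0, cmap c0 g0))) = sigma q.
    by rewrite LE /sigma /= /c0 chart_atK.
  move=> /(Cn_on_comp_affine (A := Q) (c := (0, cmap c0 g0)) LLc) H.
  have -> : sigma = fun q => g (cinv c (LL q + (0, cmap c0 g0))).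
    by apply/funext => q; rewrite sE.
  apply: H => q Qq; rewrite LE; exists (q, g0) => //.
  by split=> //; split=> //; split=> //; exact: chart_at_dom.
- move=> q [y Wy yE].
  have sy : sigma q = y by rewrite /sigma -yE gK.
  by rewrite sy; split; [exact: WU|exact: (congr1 fst yE)|exact: (congr1 snd yE)].
Qed.

(** Near the invariants of [x0], a function of the invariants is the composite of
    [F] with a section along which the frame is constant. Hence only the smoothness
    of the expression [f] that [F] takes on a level set of the frame matters. *)
Lemma descend_smooth m (F : jet R k -> 'rV[R]_m)
    (H : inv_space R n s -> 'rV[R]_m) :
  (forall x, U x -> H (invariants varpi u x) = F x) ->
  (forall x0, U x0 -> exists (Q : set (jet R k)) (f : jet R k -> 'rV[R]_m),
     [/\ Q x0, open Q, smooth_on Q f &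
       forall x, U x -> Q x -> frame x = frame x0 -> F x = f x]) ->
  smooth_on (invariants varpi u @` U) H.
Proof.
move=> HF Fs N; apply: Cn_on_local => _ [x0 Ux0 <-].
have [Q [sigma [oQ Qx0 sx0 ss sP]]] := moving_frame_section Ux0.
have [V [f [Vx0 oV fs fF]]] := Fs x0 Ux0.
pose P := Q `&` sigma @^-1` V.
have oP : open P.
  rewrite openE => q [Qq Vq]; apply: filterI.
    exact: open_nbhs_nbhs.
  apply: (ss 0%N q Qq); exact: open_nbhs_nbhs.
exists P; first by split=> //; rewrite /preimage /= sx0.
have PQ : P `<=` Q by move=> q [].
have := @Cn_on_comp _ _ _ N _ P V f sigma oP (fun q => @proj2 _ _) (fs N)
  (Cn_on_sub PQ (ss N)).
apply: Cn_on_ext oP _ => q [Qq Vq] /=.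
have [Us Is frs] := sP q Qq.
by rewrite -[in RHS]Is HF // -fF.
Qed.

End Descent.

(** * The reduced multi-contact distribution *)

Section Reduction.
Context {R : realType} {r : nat} {G : topGroupType} (LG : lie_group R r G).
Context {n : nat} {k : 'I_n -> nat} (U : set (jet R k)) (D : set (G * jet R k)).
Context (mu : G -> jet R k -> jet R k).
Context {s : nat} (varpi : jet R k -> 'rV[R]_s) (u : jet R k -> 'rV[R]_n).
Context (frame : jet R k -> G).
Context (act : local_action LG U D mu) (dc : diagonal_contact D mu)
  (inv : complete_invariants r U D mu varpi u)
  (frame_smooth : smooth_map (eucl (jet R k)) LG U frame)
  (adm : admissible LG U D mu varpi u frame).
Context (theta : G -> G -> G) (law : translation_law LG theta) (e : G -> G)
  (frame_equivariant :
    forall g x, D (g, x) -> frame (mu g x) = theta (e g) (frame x)).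

Let Di := @total_derivative R n k.
Let topv i : jet R k := pd (top_ix k i).
Let dframe x := mdiff (eucl (jet R k)) LG frame x.

Lemma near_domain g x : D (g, x) -> \forall y \near x, D (g, y).
Proof.
move=> Dgx; apply: open_nbhs_nbhs; split=> //.
apply: (@open_comp _ _ (fun y : jet R k => (g, y)) D) (la_dom_open act).
by move=> y _; exact: continuous_cst_pair.
Qed.

Lemma action_differentiable g x : D (g, x) -> differentiable (mu g) x.
Proof.
move=> Dgx; apply/mdifferentiable_eucl.
have [dp _] := mdiff_pair (mdifferentiable_cst (eucl (jet R k)) LG g x)
  (mdifferentiable_id (eucl (jet R k)) x).1.
exact: (mdiff_comp dp (smooth_map_mdifferentiable (la_smooth act) Dgx)).1.
Qed.

Lemma frame_mdifferentiable x :
  U x -> mdifferentiable (eucl (jet R k)) LG frame x.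
Proof. exact: smooth_map_mdifferentiable. Qed.

Lemma invariants_differentiable x : U x -> differentiable (invariants varpi u) x.
Proof. by move=> Ux; have [d _] := ci_smooth inv 1%N; exact: d. Qed.

Lemma diff_invariants_action g x v : D (g, x) ->
  'd (invariants varpi u) (mu g x) ('d (mu g) x v) = 'd (invariants varpi u) x v.
Proof.
move=> Dgx; have [Ux Ugx] := la_dom act Dgx.
have dI := invariants_differentiable Ugx.
have dm := action_differentiable Dgx.
have IE : {near x, invariants varpi u \o mu g =1 invariants varpi u}.
  by apply: filterS (near_domain Dgx) => y Dgy; exact: (ci_invariant inv Dgy).
have [_ dE] := near_eq_diff IE (differentiable_comp dm dI).
have cE := diff_comp dm dI.
exact: (etrans (esym (congr1 (@^~ v) cE)) (esym (congr1 (@^~ v) dE))).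
Qed.

Lemma mdiff_frame_action g x v : D (g, x) ->
  dframe (mu g x) ('d (mu g) x v) =
  mdiff LG LG (theta (e g)) (frame x) (dframe x v).
Proof.
move=> Dgx; have [Ux Ugx] := la_dom act Dgx.
have dm := (mdifferentiable_eucl _ _).1 (action_differentiable Dgx).
have dfg := frame_mdifferentiable Ugx; have df := frame_mdifferentiable Ux.
have fE : {near x, theta (e g) \o frame =1 frame \o mu g}.
  by apply: filterS (near_domain Dgx) => y Dgy; rewrite /= frame_equivariant.
have [d1 E1] := mdiff_comp df (tl_diff law (e g) (frame x)).
have [d2 E2] := mdiff_comp dm dfg.
have [_ E3] := near_eq_mdiff fE d1.
transitivity (mdiff (eucl (jet R k)) LG (frame \o mu g) x v).
  exact: esym (congr1 (@^~ v) E2).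
exact: (etrans (congr1 (@^~ v) E3) (congr1 (@^~ v) E1)).
Qed.

(** The moving frame has order below that of the highest jet coordinates. *)
Lemma mdiff_frame_top x i : U x -> dframe x (topv i) = 0.
Proof.
move=> Ux; apply/eqP/negPn/negP => d0.
have := adm_order_frame adm i; rewrite ltnNge => /negP; apply.
rewrite -[X in (X <= _)%N](coord_order_top k i) /jet_order.
apply: (leq_bigmax_cond (top_ix k i)).
by apply/asboolP; exists x.
Qed.

Lemma diff_invariants_components x : U x ->
  [/\ differentiable (@alpha R n k) x, differentiable varpi x,
      differentiable u x &
      forall v, 'd (invariants varpi u) x v =
        ('d (@alpha R n k) x v, 'd varpi x v, 'd u x v)].
Proof.
move=> Ux; have dI := invariants_differentiable Ux.
have dfst (E F : normedModType R) (f : jet R k -> E * F) : differentiable f x ->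
    differentiable (fst \o f) x /\ differentiable (snd \o f) x.
  move=> df; split; apply: differentiable_comp => //;
  apply: linear_differentiable => p; [exact: cvg_fst|exact: cvg_snd].
have [dav du] := dfst _ _ _ dI; have [da dv] := dfst _ _ _ dav.
split=> // v.
have := diff_pair (differentiable_pair da dv) du => /(congr1 (@^~ v)) /= H.
rewrite -[invariants varpi u]/(fun y => ((alpha y, varpi y), u y)).
rewrite H; have := diff_pair da dv => /(congr1 (@^~ v)) /= -> //.
Qed.

Lemma diff_alpha x v : U x -> 'd (@alpha R n k) x v = alpha v.
Proof.
move=> Ux; have [da _ _ _] := diff_invariants_components Ux.
apply/rowP => j; rewrite diff_coord // mxE.
have did : differentiable (@id (jet R k)) x by [].
have -> : (fun y : jet R k => alpha y 0 j : R) =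
    (fun y => (id y) 0 (alpha_ix k j)).
  by apply/funext => y; rewrite mxE.
by rewrite -diff_coord // diff_val.
Qed.

Lemma diff_varpi_top x i : U x -> 'd varpi x (topv i) = 0.
Proof.
move=> Ux; have [_ dv _ _] := diff_invariants_components Ux.
apply/rowP => j; rewrite diff_coord // mxE.
by have [_ [_ [vt _]]] := adm_top adm i; exact: vt.
Qed.

Lemma diff_u_top x i : U x ->
  exists2 a : R, a != 0 & 'd u x (topv i) = a *: delta_mx 0 i.
Proof.
move=> Ux; have [_ _ du _] := diff_invariants_components Ux.
have [ui [uj _]] := adm_top adm i.
exists ('D_(topv i) (fun y => u y 0 i : R) x); first exact: ui.
apply/rowP => j; rewrite diff_coord // !mxE eqxx /=.
have [->|ji] := eqVneq j i; first by rewrite mulr1.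
by rewrite mulr0; exact: uj.
Qed.

Lemma diff_action_components g x v : D (g, x) ->
  alpha ('d (mu g) x v) = alpha v /\
  'd varpi (mu g x) ('d (mu g) x v) = 'd varpi x v.
Proof.
move=> Dgx; have [Ux Ugx] := la_dom act Dgx.
have [_ _ _ E1] := diff_invariants_components Ugx.
have [_ _ _ E2] := diff_invariants_components Ux.
have E := etrans (esym (E1 _)) (etrans (diff_invariants_action v Dgx) (E2 v)).
rewrite -(diff_alpha _ Ugx) -(diff_alpha v Ux).
by split; [exact: (congr1 (fun q => q.1.1) E)|exact: (congr1 (fun q => q.1.2) E)].
Qed.

(** The action preserves each contact factor, so the image of a total derivative is
    a combination of the two generators there; it also fixes the alphas, on
    which the total derivative has derivative 1 and the other generator 0. *)
Lemma diff_action_total_derivative g x i : D (g, x) ->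
  exists b, 'd (mu g) x (Di i x) = Di i (mu g x) + b *: topv i.
Proof.
move=> Dgx; have [Ux Ugx] := la_dom act Dgx.
have inC : 'd (mu g) x (Di i x) \in contact i (mu g x).
  rewrite -(dc_contact dc Dgx) -[X in X \in _]lfunE; apply: memv_img.
  by apply: memv_span; rewrite inE eqxx.
have [a [b E]] := contactP inC; exists b; rewrite E.
have := (diff_action_components (Di i x) Dgx).1; rewrite E.
move=> /rowP /(_ i); rewrite alpha_total_derivative.
have alphaD (w1 w2 : jet R k) c1 c2 :
    alpha (c1 *: w1 + c2 *: w2) = c1 *: alpha w1 + c2 *: alpha w2.
  by apply/rowP => j; rewrite !mxE.
rewrite alphaD alpha_total_derivative alpha_pd_top scaler0 addr0 !mxE !eqxx.
by rewrite mulr1 => ->; rewrite scale1r.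
Qed.

(** The term that the action adds to a total derivative points in a direction of
    highest order, where varpi is constant. *)
Lemma diff_varpi_invariant g x i : D (g, x) ->
  'd varpi (mu g x) (Di i (mu g x)) = 'd varpi x (Di i x).
Proof.
move=> Dgx; have [Ux Ugx] := la_dom act Dgx.
have [b E] := diff_action_total_derivative i Dgx.
have lin := linear_addZ (Di i (mu g x)) b (diff_varpi_top i Ugx).
rewrite -E in lin.
exact: etrans (esym lin) (diff_action_components (Di i x) Dgx).2.
Qed.

Context (L : 'I_r -> @vfield R r G) (L_basis : vfield_basis
  [set X | exists v, forall g, X g = mdiff LG LG (theta g) 1%g v] L).

(** The coefficients of the derivative of the moving frame along a total
    derivative, in the basis of infinitesimal translations. *)
Let frame_coord i x : 'rV[R]_r :=
  dframe x (Di i x) *m invmx (vfield_mx L (frame x)).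

Lemma mdiff_frame_coord i x :
  dframe x (Di i x) = \sum_a frame_coord i x 0 a *: L a (frame x).
Proof.
have Lu := vfield_mx_unit law L_basis (frame x).
rewrite -[LHS](mulmxKV Lu) mulmx_sum_row; apply: eq_bigr => a _.
by rewrite rowK.
Qed.

(** The action moves the frame by a translation, which maps each field of the
    basis to itself; hence the coefficients do not change. *)
Lemma frame_coord_invariant g x i :
  D (g, x) -> frame_coord i (mu g x) = frame_coord i x.
Proof.
move=> Dgx; have [Ux Ugx] := la_dom act Dgx.
have [b E] := diff_action_total_derivative i Dgx.
have dE : dframe (mu g x) (Di i (mu g x)) =
    frame_coord i x *m vfield_mx L (frame (mu g x)).
  transitivity (dframe (mu g x) ('d (mu g) x (Di i x))).
    by rewrite E (linear_addZ (Di i (mu g x)) b (mdiff_frame_top i Ugx)).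
  rewrite mdiff_frame_action // mdiff_frame_coord linear_sum mulmx_sum_row.
  apply: eq_bigr => a _.
  by rewrite linearZ /= (basis_equivariant law L_basis) rowK -frame_equivariant.
by rewrite {1}/frame_coord dE mulmxK //; exact: (vfield_mx_unit law L_basis).
Qed.

(** The invariants separate the orbits; outside their range the value is
    arbitrary. *)
Lemma descend m (F : jet R k -> 'rV[R]_m) :
  (forall g x, D (g, x) -> F (mu g x) = F x) ->
  exists H : inv_space R n s -> 'rV[R]_m,
    forall x, U x -> H (invariants varpi u x) = F x.
Proof.
move=> Finv.
have orbitF x y : same_orbit D mu x y -> F x = F y.
  elim=> [{}x {}y [g Dgx ->]|//|a b c _ -> _ ->//].
  by rewrite Finv.
exists (fun q =>
  if pselect (exists2 x, U x & invariants varpi u x = q) is left ex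
  then F (projT1 (cid2 ex)) else 0).
move=> x Ux; case: pselect => [ex|[]]; last by exists x.
case: (cid2 ex) => y Uy Iy /=.
by apply: orbitF; exact: (ci_separate inv).
Qed.

Lemma varpi_smooth : smooth_on U varpi.
Proof.
move=> m.
have f1 : continuous (fst : inv_space R n s -> 'rV[R]_n * 'rV[R]_s).
  by move=> p; exact: cvg_fst.
have f2 : continuous (snd : 'rV[R]_n * 'rV[R]_s -> 'rV[R]_s).
  by move=> p; exact: cvg_snd.
have oU := la_open act.
exact: (Cn_on_comp_linear oU f2 (Cn_on_comp_linear oU f1 (ci_smooth inv m))).
Qed.

Context (phi_diffeo :
  local_diffeo (eucl (jet R k)) (frame_atlas LG n s) U
    (augmented_frame varpi u frame)).

Lemma diff_varpi_descends i : exists h : inv_space R n s -> 'rV[R]_s,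
  smooth_on (invariants varpi u @` U) h /\
  forall x, U x -> h (invariants varpi u x) = 'd varpi x (Di i x).
Proof.
have [h hE] := descend (fun g x Dgx => diff_varpi_invariant i Dgx).
exists h; split=> //; apply: (descend_smooth phi_diffeo hE) => x0 Ux0.
exists U, (fun x => 'd varpi x (Di i x)); split=> //; first exact: la_open act.
move=> m; apply: Cn_on_diff_field; first exact: la_open act.
  exact: varpi_smooth.
exact: Cn_on_total_derivative (la_open act).
Qed.

(** The coefficients read [dframe] in a chart depending on the point, and divide by
    a matrix depending on the value of the frame; both are fixed on a level set
    of the frame, which is all that is needed for a smooth quotient. *)
Lemma frame_coord_descends i : exists h : inv_space R n s -> 'rV[R]_r,
  smooth_on (invariants varpi u @` U) h /\
  forall x, U x -> h (invariants varpi u x) = frame_coord i x.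
Proof.
have [h hE] := descend (fun g x Dgx => frame_coord_invariant i Dgx).
exists h; split=> //; apply: (descend_smooth phi_diffeo hE) => x0 Ux0.
pose c0 := chart_at LG (frame x0).
pose V := U `&` frame @^-1` cdom c0.
have oV : open V.
  rewrite openE => x [Ux cx]; apply: filterI.
    by apply: open_nbhs_nbhs; split=> //; exact: la_open act.
  apply: (frame_smooth.1 x Ux); apply: open_nbhs_nbhs; split=> //.
    exact: cdom_open.
have fs m : Cn_on m V (cmap c0 \o frame).
  have := frame_smooth.2 (eucl_chart (jet R k)) c0 erefl (chart_at_charts _ _) m.
  by apply: Cn_on_sub => x [Ux cx]; exists x.
pose M := invmx (vfield_mx L (frame x0)).
exists V, (fun x => \sum_a 'd (cmap c0 \o frame) x (Di i x) 0 a *: row a M).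
split=> //; first by split=> //; exact: chart_at_dom.
  move=> m; apply: Cn_on_sum => // a; apply: Cn_on_scale => //.
    apply: (@Cn_on_comp_coord _ _ _ _ _
      (fun x => 'd (cmap c0 \o frame) x (Di i x)) a oV).
    by apply: Cn_on_diff_field => //; exact: Cn_on_total_derivative.
  exact: (Cn_on_cst m V (row a M)).
by move=> x Ux Vx fE; rewrite -mulmx_sum_row /frame_coord /dframe /mdiff fE.
Qed.

Lemma diff_augmented_frame x v : U x ->
  mdiff (eucl (jet R k)) (frame_atlas LG n s) (augmented_frame varpi u frame) x v
  = ((alpha v, 'd varpi x v, 'd u x v), dframe x v).
Proof.
move=> Ux; have dI := (mdifferentiable_eucl _ _).1 (invariants_differentiable Ux).
have [_ E] := mdiff_pair dI (frame_mdifferentiable Ux).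
apply: (etrans (congr1 (@^~ v) E)).
have [_ _ _ E'] := diff_invariants_components Ux; rewrite -(diff_alpha v Ux).
congr (_, _); exact: E'.
Qed.

(** The vectors of highest order are sent to multiples of the [d/du_j]; modulo
    these, the total derivatives are sent to the first generators of the reduced
    summands, since their derivatives of varpi and of the frame depend on the
    invariants only. The equality holds for the sums and not summand by summand:
    [u_l] may vary along the j-th total derivative for [l] different from [j]. *)
Theorem reduced_multi_contact :
  exists (h : 'I_n -> inv_space R n s -> 'rV[R]_s)
         (kk : 'I_n -> inv_space R n s -> 'rV[R]_r),
     [/\ forall j, smooth_on (invariants varpi u @` U) (h j) /\
                   smooth_on (invariants varpi u @` U) (kk j),
         forall p, directv (\sum_(j < n) reduced_summand h kk L p j)%VS
       & forall x, U x ->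
           frame_push LG varpi u frame (@multi_contact R n k) x =
           (\sum_(j < n)
              reduced_summand h kk L (augmented_frame varpi u frame x) j)%VS].
Proof.
have /choice[h hP] := diff_varpi_descends.
have /choice[kk kP] := frame_coord_descends.
exists h, kk; split; first by move=> j; split; [exact: (hP j).1|exact: (kP j).1].
  exact: directv_reduced_summand.
move=> x Ux; pose W : {vspace inv_space R n s * 'rV[R]_r} :=
  (\sum_(j < n) reduced_summand h kk L (augmented_frame varpi u frame x) j)%VS.
pose P : {vspace inv_space R n s * 'rV[R]_r} :=
  frame_push LG varpi u frame (@multi_contact R n k) x.
pose w1 j : inv_space R n s * 'rV[R]_r :=
  ((delta_mx 0 j, 'd varpi x (Di j x), 0), dframe x (Di j x)).
pose w2 j : inv_space R n s * 'rV[R]_r := ((0, 0, delta_mx 0 j), 0).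
have pushP v : v \in multi_contact x ->
    ((alpha v, 'd varpi x v, 'd u x v), dframe x v) \in P.
  move=> vC; rewrite -diff_augmented_frame // /P /frame_push.
  by rewrite -[X in X \in _]lfunE; apply: memv_img.
have contactC j v : v \in contact j x -> v \in multi_contact x.
  by apply: subvP; exact: (sumv_sup j).
have DC j : Di j x \in contact j x by apply: memv_span; rewrite inE eqxx.
have TC j : topv j \in contact j x by apply: memv_span; rewrite !inE eqxx orbT.
have topE j : exists2 a : R, a != 0 &
    ((alpha (topv j), 'd varpi x (topv j), 'd u x (topv j)), dframe x (topv j))
    = a *: w2 j.
  have [a a0 aE] := diff_u_top j Ux; exists a => //.
  rewrite aE alpha_pd_top diff_varpi_top // mdiff_frame_top //.
  by congr (_, _, _, _); rewrite /= scaler0.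
have DE j : ((alpha (Di j x), 'd varpi x (Di j x), 'd u x (Di j x)),
    dframe x (Di j x)) = w1 j + \sum_l 'd u x (Di j x) 0 l *: w2 l.
  have sumE (c : 'rV[R]_n) : \sum_l c 0 l *: w2 l = ((0, 0, c), 0).
    pose incl (d : 'rV[R]_n) : inv_space R n s * 'rV[R]_r := ((0, 0, d), 0).
    have inclD : {morph incl : d1 d2 / d1 + d2}.
      by move=> d1 d2; congr (_, _, _, _); rewrite /= addr0.
    rewrite -[RHS]/(incl c) [in RHS](row_sum_delta c).
    rewrite (big_morph incl inclD (erefl : incl 0 = 0)); apply: eq_bigr => l _.
    by congr (_, _, _, _); rewrite /= scaler0.
  rewrite sumE alpha_total_derivative.
  by congr (_, _, _, _); rewrite /= ?addr0 ?add0r.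
have WE j : reduced_summand h kk L (augmented_frame varpi u frame x) j
    = <<[:: w1 j; w2 j]>>%VS.
  rewrite /reduced_summand /= (hP j).2 // (kP j).2 //.
  by rewrite /w1 mdiff_frame_coord.
have WS j : (reduced_summand h kk L (augmented_frame varpi u frame x) j <= W)%VS.
  exact: (sumv_sup j).
have W1 j : w1 j \in W.
  apply: (subvP (WS j)).
  by rewrite WE memv_span // inE eqxx.
have W2 j : w2 j \in W.
  apply: (subvP (WS j)).
  by rewrite WE memv_span // !inE eqxx orbT.
have P2 j : w2 j \in P.
  have [a a0 aE] := topE j; have := pushP _ (contactC _ _ (TC j)); rewrite aE.
  by move=> /(memvZ a^-1); rewrite scalerA mulVf // scale1r.
have P1 j : w1 j \in P.
  have := pushP _ (contactC _ _ (DC j)); rewrite DE.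
  by rewrite rpredDr //; apply: rpred_sum => l _; apply: memvZ.
apply/eqP; rewrite -/P -/W eqEsubv; apply/andP; split.
  rewrite /P /frame_push /multi_contact limg_sum; apply/subv_sumP => j _.
  rewrite /contact limg_span; apply/span_subvP => w.
  rewrite !inE => /orP[] /eqP ->; rewrite lfunE /= diff_augmented_frame //.
    by rewrite DE memvD // memv_suml // => l _; exact: memvZ.
  by have [a _ ->] := topE j; exact: memvZ.
apply/subv_sumP => j _; rewrite WE; apply/span_subvP => w.
by rewrite !inE => /orP[] /eqP ->.
Qed.

End Reduction.

Theorem theorem4p1 (R : realType) (r : nat) (G : topGroupType)
  (LG : lie_group R r G)
  (n1 n2 : nat) (n1_gt0 : (0 < n1)%N) (n2_gt0 : (0 < n2)%N)
  (k1 : 'I_n1 -> nat) (k2 : 'I_n2 -> nat)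
  (k1_gt0 : forall i, (0 < k1 i)%N) (k2_gt0 : forall j, (0 < k2 j)%N)
  (U1 : set (jet R k1)) (D1 : set (G * jet R k1))
  (mu1 : G -> jet R k1 -> jet R k1)
  (U2 : set (jet R k2)) (D2 : set (G * jet R k2))
  (mu2 : G -> jet R k2 -> jet R k2)
  (s1 s2 : nat)
  (varpi : jet R k1 -> 'rV[R]_s1) (u : jet R k1 -> 'rV[R]_n1)
  (varsigma : jet R k2 -> 'rV[R]_s2) (v : jet R k2 -> 'rV[R]_n2)
  (rho : jet R k1 -> G) (lambda : jet R k2 -> G)
  (act1 : local_action LG U1 D1 mu1) (act2 : local_action LG U2 D2 mu2)
  (dc1 : diagonal_contact D1 mu1) (dc2 : diagonal_contact D2 mu2)
  (inv1 : complete_invariants r U1 D1 mu1 varpi u)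
  (inv2 : complete_invariants r U2 D2 mu2 varsigma v)
  (rho_right : right_moving_frame LG U1 D1 mu1 rho)
  (lambda_left : left_moving_frame LG U2 D2 mu2 lambda)
  (adm1 : admissible LG U1 D1 mu1 varpi u rho)
  (adm2 : admissible LG U2 D2 mu2 varsigma v lambda)
  (A4 : (jet_dim k1 + jet_dim k2 - r = 3 * (n1 + n2) + 1)%N)
  (phi1_diffeo : local_diffeo (eucl (jet R k1)) (frame_atlas LG n1 s1) U1
                   (augmented_frame varpi u rho))
  (phi2_diffeo : local_diffeo (eucl (jet R k2)) (frame_atlas LG n2 s2) U2
                   (augmented_frame varsigma v lambda))
  (L1 R2 : 'I_r -> @vfield R r G)
  (L1_basis : vfield_basis (inf_left_translation LG) L1)
  (R2_basis : vfield_basis (inf_right_translation LG) R2) :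
  (exists (h : 'I_n1 -> inv_space R n1 s1 -> 'rV[R]_s1)
          (k : 'I_n1 -> inv_space R n1 s1 -> 'rV[R]_r),
     [/\ forall j, smooth_on (invariants varpi u @` U1) (h j) /\
                   smooth_on (invariants varpi u @` U1) (k j),
         forall p, directv (\sum_(j < n1) reduced_summand h k L1 p j)%VS
       & forall x, U1 x ->
           frame_push LG varpi u rho (@multi_contact R n1 k1) x =
           (\sum_(j < n1)
              reduced_summand h k L1 (augmented_frame varpi u rho x) j)%VS]) /\
  (exists (m : 'I_n2 -> inv_space R n2 s2 -> 'rV[R]_s2)
          (n : 'I_n2 -> inv_space R n2 s2 -> 'rV[R]_r),
     [/\ forall l, smooth_on (invariants varsigma v @` U2) (m l) /\
                   smooth_on (invariants varsigma v @` U2) (n l),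
         forall p, directv (\sum_(l < n2) reduced_summand m n R2 p l)%VS
       & forall y, U2 y ->
           frame_push LG varsigma v lambda (@multi_contact R n2 k2) y =
           (\sum_(l < n2)
              reduced_summand m n R2 (augmented_frame varsigma v lambda y) l)%VS]).
Proof.
split.
- pose theta (p h : G) := (h * p)%g.
  have law : translation_law LG theta := right_mul_law LG.
  have equiv g x : D1 (g, x) -> rho (mu1 g x) = theta (g^-1)%g (rho x).
    exact: rho_right.2.
  exact: (reduced_multi_contact act1 dc1 inv1 rho_right.1 adm1 law equiv
    L1_basis phi1_diffeo).
- pose theta (p h : G) := (p * h)%g.
  have law : translation_law LG theta := left_mul_law LG.
  have equiv g y : D2 (g, y) -> lambda (mu2 g y) = theta g (lambda y).
    exact: lambda_left.2.
  exact: (reduced_multi_contact act2 dc2 inv2 lambda_left.1 adm2 law equiv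
    R2_basis phi2_diffeo).
Qed.
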